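(* Let $\Gamma=[\gamma_{ij}]\in\mathbb{R}^{p\times p}$ be a connected continuous-time interconnection and let $Q:\mathbb{R}_{\ge0}\to\overline{\mathcal Q}_n$ be Riemann-integrable and persistently exciting. Then the solutions $x_i(\cdot)$ of $\dot x_i=Q_t\sum_{j\ne i}\gamma_{ij}(x_j-x_i)$, $i=1,\dots,p$, exponentially synchronize to $\bar x(t)\equiv(r^T\otimes I_n)\mathbf x(0)$, where $\mathbf x=[x_1^T\cdots x_p^T]^T$ and $r^T\Gamma=0$, $r^T\mathbf 1=1$.
   Context: $|\cdot|$ induced 2-norm; $\mathbf 1$ all-ones vector; $\otimes$ Kronecker product; $\sigma_{\min}$ smallest singular value; $\overline{\mathcal Q}_n$ the set of symmetric positive semidefinite $n\times n$ matrices $R$ with $|R|\le1$. $Q$ is persistently exciting if there exist $\varepsilon,T>0$ with $\sigma_{\min}\big(\int_t^{t+T}Q_\tau d\tau\big)\ge\varepsilon$ for all $t\ge0$. Continuous-time interconnection: $\gamma_{ij}\ge0$ ($i\ne j$), $\gamma_{ii}=-\sum_{j\ne i}\gamma_{ij}$; graph edge $(n_i,n_j)$ iff $\gamma_{ij}>0$; connected if some node is reachable by a directed path from every other node. Exponential synchronization to $\bar x$: there are $c,\alpha>0$ with $\max_i|x_i(t)-\bar x(t)|\le ce^{-\alpha t}$ for all $t\ge0$. *)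

(* Defs.v *)
From HB Require Import structures.
From Stdlib Require Import Reals.
From Coquelicot Require Import Coquelicot.
From mathcomp Require Import all_boot all_order all_algebra.
From mathcomp Require Import classical_sets reals Rstruct.
Set Implicit Arguments. Unset Strict Implicit. Unset Printing Implicit Defensive.
Import Order.TTheory GRing.Theory Num.Theory.
Local Open Scope classical_set_scope.
Local Open Scope ring_scope.

Definition vnorm2 (n : nat) (v : 'cV[R]_n) : R := Num.sqrt (\sum_(k < n) v k 0 ^+ 2).

Definition opnorm2 (n : nat) (A : 'M[R]_n) : R :=
  sup [set vnorm2 (A *m v) | v in [set v : 'cV[R]_n | vnorm2 v = 1]].

Definition sigma_min (n : nat) (A : 'M[R]_n) : R :=
  inf [set vnorm2 (A *m v) | v in [set v : 'cV[R]_n | vnorm2 v = 1]].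

Definition in_Qbar (n : nat) (A : 'M[R]_n) : Prop :=
  A^T = A /\ (forall v : 'cV[R]_n, 0 <= (v^T *m A *m v) 0 0) /\ opnorm2 A <= 1.

Definition mxRInt (n : nat) (Q : R -> 'M[R]_n) (a b : R) : 'M[R]_n :=
  \matrix_(i, j) RInt (fun s => Q s i j) a b.

Definition mx_Riemann_integrable (n : nat) (Q : R -> 'M[R]_n) : Prop :=
  forall (i j : 'I_n) (a b : R), 0 <= a -> a <= b -> ex_RInt (fun s => Q s i j) a b.

Definition persistently_exciting (n : nat) (Q : R -> 'M[R]_n) : Prop :=
  exists eps T : R, 0 < eps /\ 0 < T /\
    forall t : R, 0 <= t -> eps <= sigma_min (mxRInt Q t (t + T)).

Definition ct_interconnection (p : nat) (G : 'M[R]_p) : Prop :=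
  (forall i j : 'I_p, i != j -> 0 <= G i j) /\
  (forall i : 'I_p, G i i = - \sum_(j < p | j != i) G i j).

Definition edge (p : nat) (G : 'M[R]_p) : rel 'I_p := fun i j => 0 < G i j.

Definition connected_interconnection (p : nat) (G : 'M[R]_p) : Prop :=
  exists k : 'I_p, forall i : 'I_p, i != k -> connect (edge G) i k.

Definition cons_rhs (n p : nat) (G : 'M[R]_p) (Q : R -> 'M[R]_n)
  (x : 'I_p -> R -> 'cV[R]_n) (i : 'I_p) (s : R) : 'cV[R]_n :=
  Q s *m (\sum_(j < p | j != i) G i j *: (x j s - x i s)).

(* x is a (Caratheodory / integral-form) solution on [0, oo) *)
Definition is_solution (n p : nat) (G : 'M[R]_p) (Q : R -> 'M[R]_n)
  (x : 'I_p -> R -> 'cV[R]_n) : Prop :=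
  forall (i : 'I_p) (k : 'I_n) (t : R), 0 <= t ->
    ex_RInt (fun s => cons_rhs G Q x i s k 0) 0 t /\
    x i t k 0 = x i 0 k 0 + RInt (fun s => cons_rhs G Q x i s k 0) 0 t.

Definition exp_synchronize (n p : nat) (x : 'I_p -> R -> 'cV[R]_n)
  (xbar : R -> 'cV[R]_n) : Prop :=
  exists c alpha : R, 0 < c /\ 0 < alpha /\
    forall t : R, 0 <= t ->
      \big[Num.max/0]_(i < p) vnorm2 (x i t - xbar t) <= c * exp (- alpha * t).

(* Main.v *)
(* Let X be the matrix whose rows are the states, so that X' = G X Q. For small
   h > 0 the matrix A = 1 + h G is stochastic with positive diagonal and, by
   connectedness, some power A^N contracts the disagreement
   sum_(i, j) |x_i - x_j|_Q^2 by the factor 1/2, simultaneously for all positive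
   semidefinite Q. Hence V = sum_(k < N) disagreement (A^k X), taken with Q = I, has
   derivative 2 sum_(k < N) disagreement_Q (A^k X, A^k G X) (the symmetric factor Q
   moves from the velocity into the form), which telescopes to at most
   - disagreement_Q X / (2h). Persistent excitation, together with the slow motion
   of X when the dissipated energy S is small, bounds S over a period from below by a
   multiple of V, so V decays geometrically. Finally r^T X is conserved and
   x_i - xbar = sum_j r_j (x_i - x_j). *)
From Stdlib Require Import Reals Lra ClassicalEpsilon.
From Coquelicot Require Import Coquelicot.

(** * Integral calculus for primitives of Riemann-integrable functions *)

Section Primitives.
Local Open Scope R_scope.

(* [h] is [f] times a step function with mesh [d] approximating [w]; [f * w] is a uniform limit of such functions, hence integrable. *)
Lemma ex_RInt_mult_step (f w : R -> R) a b M L n eta d : 0 < eta -> 0 <= M -> 0 <= L ->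
  M * L * d <= eta ->
  ex_RInt f a b ->
  (forall x, a <= x <= b -> Rabs (f x) <= M) ->
  (forall x y, a <= x <= b -> a <= y <= b -> Rabs (w x - w y) <= L * Rabs (x - y)) ->
  a <= b -> b - a <= INR n * d ->
  exists h, ex_RInt h a b /\
    forall x, a <= x <= b -> Rabs (h x - f x * w x) <= eta.
Proof.
intros He HM HL Hd; revert a b; induction n as [|n IH]; intros a b Hf Hfb Hw Hab Hn.
  exists (fun _ => f a * w a); split; [apply ex_RInt_const|].
  intros x Hx; simpl in Hn; replace x with a by lra.
  rewrite Rminus_eq_0, Rabs_R0; lra.
assert (Hpc : forall a' b', a <= a' <= b' -> b' <= b -> b' - a' <= d ->
  exists h, ex_RInt h a' b' /\
    forall x, a' <= x <= b' -> Rabs (h x - f x * w x) <= eta).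
  intros a' b' H1 H2 H3; exists (fun x => w a' * f x); split.
    apply (ex_RInt_scal (V := R_NormedModule)).
    apply (ex_RInt_Chasles_1 (V := R_CompleteNormedModule)) with b; [lra|].
    apply (ex_RInt_Chasles_2 (V := R_CompleteNormedModule)) with a; [lra|exact Hf].
  intros x Hx; replace (w a' * f x - f x * w x) with (f x * (w a' - w x)) by ring.
  rewrite Rabs_mult.
  apply Rle_trans with (M * (L * d)); [|lra].
  apply Rmult_le_compat; try apply Rabs_pos; [apply Hfb; lra|].
  eapply Rle_trans; [apply Hw; lra|].
  apply Rmult_le_compat_l; [exact HL|].
  rewrite Rabs_left1; lra.
rewrite S_INR in Hn.
destruct (Rle_dec (b - a) d) as [Hs|Hs]; [apply Hpc; lra|].
destruct (Rle_dec 0 d) as [Hd0|Hd0]; [|pose proof (pos_INR n); nra].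
set (c := a + d).
destruct (Hpc a c) as [h1 [I1 B1]]; try (unfold c; lra).
destruct (IH c b) as [h2 [I2 B2]]; try (unfold c; lra).
- apply (ex_RInt_Chasles_2 (V := R_CompleteNormedModule)) with a; [unfold c; lra|exact Hf].
- intros x Hx; apply Hfb; unfold c in Hx; lra.
- intros x y Hx Hy; apply Hw; unfold c in *; lra.
exists (fun x => if Rlt_dec x c then h1 x else h2 x); split.
  apply ex_RInt_Chasles with c.
    apply ex_RInt_ext with h1; [|exact I1].
    intros x; rewrite Rmin_left, Rmax_right by (unfold c; lra); intros Hx.
    destruct (Rlt_dec x c); [reflexivity|lra].
  apply ex_RInt_ext with h2; [|exact I2].
  intros x; rewrite Rmin_left, Rmax_right by (unfold c; lra); intros Hx.
  destruct (Rlt_dec x c); [lra|reflexivity].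
intros x Hx; destruct (Rlt_dec x c); [apply B1|apply B2]; lra.
Qed.

(** Primitives of Riemann-integrable functions are Lipschitz on bounded intervals, so this is the
    integrability that the product rule needs. *)
Lemma ex_RInt_mult_lipschitz (f w : R -> R) a b L : a <= b -> ex_RInt f a b -> 0 <= L ->
  (forall x y, a <= x <= b -> a <= y <= b -> Rabs (w x - w y) <= L * Rabs (x - y)) ->
  ex_RInt (fun s => f s * w s) a b.
Proof.
intros Hab Hf HL Hw.
destruct (ex_RInt_ub f a b Hf) as [M0 HM0].
set (M := Rabs M0).
assert (HM : 0 <= M) by apply Rabs_pos.
assert (Hfb : forall x, a <= x <= b -> Rabs (f x) <= M).
  intros x Hx; eapply Rle_trans; [|apply Rle_abs].
  apply (HM0 x); rewrite Rmin_left, Rmax_right; lra.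
assert (Happ : forall m : nat, exists h, ex_RInt h a b /\
    forall x, a <= x <= b -> Rabs (h x - f x * w x) <= / INR (S m)).
  intros m.
  assert (He : 0 < / INR (S m)) by (apply Rinv_0_lt_compat, lt_0_INR; apply Nat.lt_0_succ).
  (* The [+ 1] keeps the mesh well defined when [M * L = 0]. *)
  set (d := / INR (S m) / (M * L + 1)).
  assert (HML : 0 <= M * L) by (apply Rmult_le_pos; assumption).
  assert (Hd : 0 < d) by (apply Rdiv_lt_0_compat; lra).
  assert (Hd' : M * L * d <= / INR (S m)).
    assert (E : (M * L + 1) * d = / INR (S m))
      by (unfold d, Rdiv; rewrite Rmult_comm, Rmult_assoc, Rinv_l; lra).
    rewrite <- E, Rmult_plus_distr_r; lra.
  destruct (INR_unbounded ((b - a) / d)) as [n Hn].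
  apply (ex_RInt_mult_step f w a b M L n _ d); auto.
  apply Rmult_le_reg_r with (/ d); [apply Rinv_0_lt_compat; exact Hd|].
  rewrite Rmult_assoc, Rinv_r by lra.
  unfold Rdiv in Hn; lra.
set (h := fun m => proj1_sig (constructive_indefinite_description _ (Happ m))).
assert (Hh : forall m, ex_RInt (h m) a b /\
    forall x, a <= x <= b -> Rabs (h m x - f x * w x) <= / INR (S m))
  by exact (fun m => proj2_sig (constructive_indefinite_description _ (Happ m))).
set (inab := fun x => if Rle_dec a x then if Rle_dec x b then true else false else false).
(* [filterlim_RInt] asks for uniform convergence on the whole line, so outside [[a, b]] the
   approximants are set equal to the limit. *)
set (g := fun m x => if inab x then h m x else f x * w x).
destruct (filterlim_RInt (V := R_CompleteNormedModule) g a b eventually _ (fun x => f x * w x)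
   (fun m => RInt (g m) a b)) as [I [_ HI]].
- intros m; apply (RInt_correct (V := R_CompleteNormedModule)).
  apply ex_RInt_ext with (h m); [|apply Hh].
  rewrite Rmin_left, Rmax_right by lra; intros x Hx; unfold g, inab.
  destruct (Rle_dec a x); [destruct (Rle_dec x b)|]; try reflexivity; lra.
- intros P [eps HP].
  destruct (archimed_cor1 eps (cond_pos eps)) as [N [HN HN0]].
  exists N; intros m Hm; apply HP; intros x.
  unfold g, inab.
  destruct (Rle_dec a x); [destruct (Rle_dec x b)|]; try apply ball_center.
  change (Rabs (h m x - f x * w x) < eps).
  eapply Rle_lt_trans; [apply Hh; lra|].
  eapply Rle_lt_trans; [|exact HN].
  apply Rinv_le_contravar; [apply lt_0_INR; exact HN0|].
  apply le_INR; apply (Nat.le_trans _ _ _ Hm); apply Nat.le_succ_diag_r.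
- exists I; exact HI.
Qed.

(** Stated through the integral and not the derivative: with [Q] merely Riemann-integrable,
    solutions need not be differentiable everywhere. *)
Definition is_primitive (u f : R -> R) : Prop :=
  forall t, 0 <= t -> ex_RInt f 0 t /\ u t = u 0 + RInt f 0 t.

Lemma primitive_is_RInt u f a b : is_primitive u f -> 0 <= a <= b ->
  is_RInt f a b (u b - u a).
Proof.
intros H Hab.
destruct (H a) as [_ Ea]; [lra|]; destruct (H b) as [Ib Eb]; [lra|].
assert (I : ex_RInt f a b)
  by (apply (ex_RInt_Chasles_2 (V := R_CompleteNormedModule)) with 0; [lra|exact Ib]).
assert (I0 : ex_RInt f 0 a)
  by (apply (ex_RInt_Chasles_1 (V := R_CompleteNormedModule)) with b; [lra|exact Ib]).
replace (u b - u a) with (RInt f a b); [apply (RInt_correct (V := R_CompleteNormedModule)); exact I|].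
rewrite Ea, Eb, <- (RInt_Chasles f 0 a b) by assumption.
change (plus (RInt f 0 a) (RInt f a b)) with (RInt f 0 a + RInt f a b); lra.
Qed.

Lemma primitive_of_is_RInt u f :
  (forall t, 0 <= t -> is_RInt f 0 t (u t - u 0)) -> is_primitive u f.
Proof.
intros H t Ht; split; [eexists; apply H, Ht|].
rewrite (is_RInt_unique _ _ _ _ (H t Ht)); ring.
Qed.

Lemma primitive_le u w f g a b : is_primitive u f -> is_primitive w g ->
  0 <= a -> a <= b -> (forall s, a <= s -> s <= b -> f s <= g s) ->
  u b - u a <= w b - w a.
Proof.
intros Hu Hw Ha Hab Hfg.
apply (is_RInt_le f g a b); [exact Hab| | |intros x Hx; apply Hfg; lra];
  apply primitive_is_RInt; try assumption; lra.
Qed.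

Lemma primitive_ext u w f g : is_primitive u f ->
  (forall s, 0 <= s -> u s = w s) -> (forall s, 0 <= s -> f s = g s) -> is_primitive w g.
Proof.
intros H Huw Hfg; apply primitive_of_is_RInt; intros t Ht.
rewrite <- !Huw by lra.
apply (is_RInt_ext f); [|apply primitive_is_RInt; [exact H|lra]].
rewrite Rmin_left, Rmax_right by lra; intros x Hx; apply Hfg; lra.
Qed.

Lemma primitive_const c : is_primitive (fun _ => c) (fun _ => 0).
Proof.
apply primitive_of_is_RInt; intros t Ht.
replace (c - c) with (scal (t - 0) 0); [apply (is_RInt_const (V := R_NormedModule))|].
unfold scal; simpl; unfold mult; simpl; ring.
Qed.

Lemma primitive_linear c : is_primitive (fun t => c * t) (fun _ => c).
Proof.
apply primitive_of_is_RInt; intros t Ht.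
replace (c * t - c * 0) with (scal (t - 0) c); [apply (is_RInt_const (V := R_NormedModule))|].
unfold scal; simpl; unfold mult; simpl; ring.
Qed.

Lemma primitive_RInt f : (forall t, 0 <= t -> ex_RInt f 0 t) ->
  is_primitive (fun t => RInt f 0 t) f.
Proof.
intros H t Ht; split; [apply H, Ht|].
rewrite RInt_point; symmetry; apply Rplus_0_l.
Qed.

Lemma primitive_plus u w f g : is_primitive u f -> is_primitive w g ->
  is_primitive (fun t => u t + w t) (fun t => f t + g t).
Proof.
intros Hu Hw; apply primitive_of_is_RInt; intros t Ht.
replace (u t + w t - (u 0 + w 0)) with (plus (u t - u 0) (w t - w 0))
  by (unfold plus; simpl; ring).
apply (is_RInt_plus (V := R_NormedModule)); apply primitive_is_RInt; try assumption; lra.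
Qed.

Lemma primitive_scal c u f : is_primitive u f ->
  is_primitive (fun t => c * u t) (fun t => c * f t).
Proof.
intros Hu; apply primitive_of_is_RInt; intros t Ht.
replace (c * u t - c * u 0) with (scal c (u t - u 0))
  by (unfold scal; simpl; unfold mult; simpl; ring).
apply (is_RInt_scal (V := R_NormedModule)); apply primitive_is_RInt; try assumption; lra.
Qed.

(** A Riemann-integrable function is bounded on [[0, T]]; comparing [u] with the linear functions of
    slopes plus and minus that bound gives the Lipschitz estimate. *)
Lemma primitive_lipschitz u f T : 0 <= T -> is_primitive u f ->
  exists L, 0 <= L /\ (forall x, 0 <= x <= T -> Rabs (f x) <= L) /\
   forall x y, 0 <= x <= T -> 0 <= y <= T -> Rabs (u x - u y) <= L * Rabs (x - y).
Proof.
intros HT Hu.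
destruct (Hu T HT) as [If _].
destruct (ex_RInt_ub f 0 T If) as [M0 HM0].
assert (Hfb : forall x, 0 <= x <= T -> Rabs (f x) <= Rabs M0).
  intros x Hx; eapply Rle_trans; [|apply Rle_abs].
  apply (HM0 x); rewrite Rmin_left, Rmax_right; lra.
exists (Rabs M0); split; [apply Rabs_pos|split; [exact Hfb|]].
assert (H : forall x y, 0 <= x <= T -> 0 <= y <= T -> x <= y ->
    Rabs (u x - u y) <= Rabs M0 * Rabs (x - y)).
  intros x y Hx Hy Hxy.
  rewrite (Rabs_left1 (x - y)) by lra.
  rewrite (Rabs_minus_sym (u x)); apply Rabs_le.
  pose proof (primitive_linear (Rabs M0)) as H1.
  pose proof (primitive_linear (- Rabs M0)) as H2.
  pose proof (primitive_le _ _ _ _ x y Hu H1) as H3.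
  pose proof (primitive_le _ _ _ _ x y H2 Hu) as H4.
  simpl in H3, H4.
  assert (u y - u x <= Rabs M0 * y - Rabs M0 * x).
    apply H3; try lra; intros s Hs Hs'.
    eapply Rle_trans; [apply Rle_abs|apply Hfb; lra].
  assert (- Rabs M0 * y - - Rabs M0 * x <= u y - u x).
    apply H4; try lra; intros s Hs Hs'.
    assert (Hss : 0 <= s <= T) by lra.
    pose proof (Hfb s Hss).
    pose proof (Rabs_maj2 (f s)); lra.
  lra.
intros x y Hx Hy; destruct (Rle_dec x y).
  apply H; lra.
rewrite Rabs_minus_sym, (Rabs_minus_sym x); apply H; lra.
Qed.

Lemma ex_RInt_mult_primitive (f u g : R -> R) a b : 0 <= a <= b -> ex_RInt f a b -> is_primitive u g ->
  ex_RInt (fun s => f s * u s) a b.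
Proof.
intros Hab Hf Hu.
destruct (primitive_lipschitz u g b) as [L [HL [_ Hl]]]; [lra|exact Hu|].
apply ex_RInt_mult_lipschitz with L; [lra|exact Hf|exact HL|].
intros x y Hx Hy; apply Hl; lra.
Qed.

(* [f] and [g] need not be continuous, so [u * w] need not be differentiable; however its increments differ from those of the integral of [f * w + u * g] by O(|t - s|^2), so the difference of the two functions has derivative zero. *)
Lemma primitive_mult u w f g : is_primitive u f -> is_primitive w g ->
  is_primitive (fun t => u t * w t) (fun t => f t * w t + u t * g t).
Proof.
intros Hu Hw.
assert (I1 : forall a b, 0 <= a <= b -> ex_RInt (fun s => f s * w s + u s * g s) a b).
  intros a b Hab; apply (ex_RInt_plus (V := R_NormedModule)).
    apply ex_RInt_mult_primitive with g; try assumption.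
    eexists; apply primitive_is_RInt; eassumption.
  apply ex_RInt_ext with (fun s => g s * u s); [intros; apply Rmult_comm|].
  apply ex_RInt_mult_primitive with f; try assumption.
  eexists; apply primitive_is_RInt; eassumption.
set (F := fun s => f s * w s + u s * g s).
assert (HF : is_primitive (fun t => RInt F 0 t) F)
  by (apply primitive_RInt; intros t Ht; apply I1; lra).
intros T HT; split; [apply I1; lra|].
destruct (primitive_lipschitz u f T HT Hu) as [Lu [HLu [Hfb Hul]]].
destruct (primitive_lipschitz w g T HT Hw) as [Lw [HLw [Hgb Hwl]]].
set (C := 2 * (Lu * Lw)).
assert (HC : 0 <= C) by (unfold C; pose proof (Rmult_le_pos _ _ HLu HLw); lra).
set (Phi := fun t => u t * w t - RInt F 0 t).
assert (Hq : forall s t, 0 <= s -> s <= t -> t <= T ->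
    Rabs (Phi t - Phi s) <= C * (t - s) * (t - s)).
  intros s t Hs Hst HtT.
  (* With [w t] and [u s] frozen, the increment of [w t * u + u s * w] over [[s, t]] is exactly
     [u t * w t - u s * w s]. *)
  assert (H0 : is_primitive (fun tau => (w t * u tau + u s * w tau) + (- 1) * RInt F 0 tau)
     (fun tau => (w t * f tau + u s * g tau) + (- 1) * F tau)).
    apply primitive_plus; [apply primitive_plus|]; apply primitive_scal; assumption.
  assert (Hb : forall tau, s <= tau -> tau <= t ->
     Rabs ((w t * f tau + u s * g tau) + (- 1) * F tau) <= C * (t - s)).
    intros tau H1 H2; unfold F.
    replace (_ + _) with (f tau * (w t - w tau) + g tau * (u s - u tau)) by ring.
    eapply Rle_trans; [apply Rabs_triang|].
    rewrite !Rabs_mult.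
    assert (Rabs (w t - w tau) <= Lw * (t - s)).
      eapply Rle_trans; [apply Hwl; lra|].
      apply Rmult_le_compat_l; [exact HLw|rewrite Rabs_right; lra].
    assert (Rabs (u s - u tau) <= Lu * (t - s)).
      eapply Rle_trans; [apply Hul; lra|].
      apply Rmult_le_compat_l; [exact HLu|rewrite Rabs_left1; lra].
    assert (Rabs (f tau) * Rabs (w t - w tau) <= Lu * (Lw * (t - s)))
      by (apply Rmult_le_compat; try apply Rabs_pos; [apply Hfb; lra|assumption]).
    assert (Rabs (g tau) * Rabs (u s - u tau) <= Lw * (Lu * (t - s)))
      by (apply Rmult_le_compat; try apply Rabs_pos; [apply Hgb; lra|assumption]).
    unfold C; lra.
  pose proof (primitive_le _ _ _ _ s t H0 (primitive_linear (C * (t - s))) Hs Hst) as U.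
  pose proof (primitive_le _ _ _ _ s t (primitive_linear (- (C * (t - s)))) H0 Hs Hst) as U'.
  simpl in U, U'.
  apply Rabs_le; unfold Phi; split.
    cut (- (C * (t - s)) * t - - (C * (t - s)) * s <= w t * u t + u s * w t + -1 * RInt F 0 t - (w t * u s + u s * w s + -1 * RInt F 0 s)); [lra|].
    apply U'; intros tau H1 H2; specialize (Hb tau H1 H2).
    pose proof (Rabs_maj2 (w t * f tau + u s * g tau + -1 * F tau)); lra.
  cut (w t * u t + u s * w t + -1 * RInt F 0 t - (w t * u s + u s * w s + -1 * RInt F 0 s) <= (C * (t - s)) * t - (C * (t - s)) * s); [lra|].
  apply U; intros tau H1 H2; specialize (Hb tau H1 H2).
  eapply Rle_trans; [apply Rle_abs|exact Hb].
(* Summing the quadratic estimate over [n] steps of length [h] gives [C * h * h * n], which is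
   [C * T * T / n] at [h = T / n] and can be made arbitrarily small. *)
assert (Hsum : forall n h, 0 <= h -> INR n * h <= T ->
    Rabs (Phi (INR n * h) - Phi 0) <= C * h * h * INR n).
  induction n as [|n IH]; intros h Hh HnT.
    simpl; rewrite Rmult_0_l, Rminus_eq_0, Rabs_R0; lra.
  rewrite S_INR in *.
  pose proof (pos_INR n).
  assert (0 <= INR n * h) by (apply Rmult_le_pos; assumption).
  replace (Phi ((INR n + 1) * h) - Phi 0) with
    ((Phi ((INR n + 1) * h) - Phi (INR n * h)) + (Phi (INR n * h) - Phi 0)) by ring.
  eapply Rle_trans; [apply Rabs_triang|].
  assert (Rabs (Phi ((INR n + 1) * h) - Phi (INR n * h)) <= C * h * h).
    eapply Rle_trans; [apply Hq; lra|].
    replace ((INR n + 1) * h - INR n * h) with h by ring; lra.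
  assert (Rabs (Phi (INR n * h) - Phi 0) <= C * h * h * INR n) by (apply IH; lra).
  lra.
assert (E : Phi T = Phi 0).
  apply Rminus_diag_uniq.
  destruct (Req_dec (Phi T - Phi 0) 0) as [|Hne]; [assumption|exfalso].
  pose proof (Rabs_pos_lt _ Hne) as Hp.
  destruct (INR_unbounded (C * T * T / Rabs (Phi T - Phi 0))) as [n Hn].
  assert (H1 : 0 < INR (S n)) by (apply lt_0_INR, Nat.lt_0_succ).
  assert (H2 : INR n < INR (S n)) by (rewrite S_INR; lra).
  assert (Hh : 0 <= T / INR (S n)) by (apply Rdiv_le_0_compat; lra).
  assert (HT' : INR (S n) * (T / INR (S n)) = T) by (field; lra).
  pose proof (Hsum (S n) _ Hh (Req_le _ _ HT')) as H3.
  rewrite HT' in H3.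
  replace (C * (T / INR (S n)) * (T / INR (S n)) * INR (S n)) with (C * T * T / INR (S n)) in H3 by (field; lra).
  assert (H4 : C * T * T < INR (S n) * Rabs (Phi T - Phi 0)).
    apply Rmult_lt_reg_r with (/ Rabs (Phi T - Phi 0)); [apply Rinv_0_lt_compat; exact Hp|].
    replace (INR (S n) * Rabs (Phi T - Phi 0) * / Rabs (Phi T - Phi 0)) with (INR (S n))
      by (field; lra).
    unfold Rdiv in Hn; lra.
  apply (Rmult_le_compat_r (INR (S n))) in H3; [|lra].
  unfold Rdiv in H3; rewrite (Rmult_assoc _ (/ _)), Rinv_l in H3 by lra; lra.
unfold Phi in E; rewrite RInt_point in E; unfold zero in E; simpl in E.
fold F; lra.
Qed.

(** Monotonicity covers the first period, and every further period contributes one factor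
    [rh = exp (- al * T)]. *)
Lemma geometric_decay_exp (V : R -> R) (T rho : R) : 0 < T -> rho < 1 ->
  (forall t, 0 <= t -> 0 <= V t) ->
  (forall s t, 0 <= s -> s <= t -> V t <= V s) ->
  (forall t, 0 <= t -> V (t + T) <= rho * V t) ->
  exists c alpha, 0 < c /\ 0 < alpha /\ forall t, 0 <= t -> V t <= c * exp (- alpha * t).
Proof.
intros HT Hrho HV0 Hmon Hdec.
(* [rho] may be nonpositive; the maximum makes [ln rh] meaningful. *)
set (rh := Rmax rho (/ 2)).
assert (Hr : 0 < rh < 1).
  unfold rh; split; [apply Rlt_le_trans with (/2); [lra|apply Rmax_r]|].
  apply Rmax_lub_lt; lra.
assert (Hdec' : forall t, 0 <= t -> V (t + T) <= rh * V t).
  intros t Ht; eapply Rle_trans; [apply Hdec, Ht|].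
  apply Rmult_le_compat_r; [apply HV0, Ht|apply Rmax_l].
set (al := - ln rh / T).
assert (Hal : 0 < al).
  apply Rdiv_lt_0_compat; [|exact HT].
  pose proof (ln_increasing rh 1 (proj1 Hr) (proj2 Hr)); rewrite ln_1 in *; lra.
assert (HeT : rh * exp (al * T) = 1).
  rewrite <- (exp_ln rh (proj1 Hr)) at 1; rewrite <- exp_plus.
  replace (ln rh + al * T) with 0 by (unfold al; field; lra); apply exp_0.
(* The exponential compensates the decay of [exp (- al * t)] within the first period; the [+ 1]
   makes [c] positive even if [V 0 = 0]. *)
set (c := (V 0 + 1) * exp (al * T)).
assert (Hc : 0 < c).
  apply Rmult_lt_0_compat; [specialize (HV0 0 (Rle_refl 0)); lra|apply exp_pos].
exists c, al; split; [exact Hc|split; [exact Hal|]].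
assert (H : forall n t, 0 <= t -> t <= INR n * T -> V t <= c * exp (- al * t)).
  assert (Hbase : forall t, 0 <= t -> t <= T -> V t <= c * exp (- al * t)).
    intros t H1 H2; unfold c; rewrite Rmult_assoc, <- exp_plus.
    apply Rle_trans with (V 0 + 1); [pose proof (Hmon 0 t (Rle_refl 0) H1); lra|].
    rewrite <- (Rmult_1_r (V 0 + 1)) at 1.
    apply Rmult_le_compat_l; [specialize (HV0 0 (Rle_refl 0)); lra|].
    rewrite <- exp_0.
    assert (0 <= al * T + - al * t) by (replace (al * T + - al * t) with (al * (T - t)) by ring; apply Rmult_le_pos; lra).
    destruct (Req_dec (al * T + - al * t) 0) as [->|]; [lra|].
    left; apply exp_increasing; lra.
  induction n as [|n IH]; intros t Ht Hn.
    simpl in Hn; apply Hbase; lra.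
  rewrite S_INR in Hn.
  destruct (Rle_dec t T); [apply Hbase; lra|].
  replace t with ((t - T) + T) at 1 by ring.
  eapply Rle_trans; [apply Hdec'; lra|].
  apply Rle_trans with (rh * (c * exp (- al * (t - T)))).
    apply Rmult_le_compat_l; [lra|apply IH; lra].
  replace (- al * (t - T)) with (al * T + - al * t) by ring.
  rewrite exp_plus.
  replace (rh * (c * (exp (al * T) * exp (- al * t)))) with ((rh * exp (al * T)) * (c * exp (- al * t))) by ring.
  rewrite HeT; lra.
intros t Ht; destruct (INR_unbounded (t / T)) as [n Hn].
apply (H n); [exact Ht|].
apply Rmult_le_reg_r with (/ T); [apply Rinv_0_lt_compat; exact HT|].
rewrite Rmult_assoc, Rinv_r by lra; unfold Rdiv in Hn; lra.
Qed.

End Primitives.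

Require Import Defs.
From HB Require Import structures.
From mathcomp Require Import all_boot all_order all_algebra.
From mathcomp Require Import ring lra.
From mathcomp Require Import classical_sets reals Rstruct.
Set Implicit Arguments. Unset Strict Implicit. Unset Printing Implicit Defensive.
Import Order.TTheory GRing.Theory Num.Theory.
Local Open Scope ring_scope.

(** * Semidefinite forms on row vectors and the disagreement of a family of rows *)

Definition bform (F : realFieldType) n (Q : 'M[F]_n) (u v : 'rV[F]_n) : F :=
  (u *m Q *m v^T) 0 0.

Definition psd (F : realFieldType) n (Q : 'M[F]_n) : Prop :=
  Q^T = Q /\ forall v, 0 <= bform Q v v.

(* Twice the quadratic form of the complete-graph Laplacian, tensored with [Q]; the rows of [X] are the agents' states. *)
Definition disagreement (F : realFieldType) n p (Q : 'M[F]_n) (X Y : 'M[F]_(p, n)) : F :=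
  \sum_i \sum_j bform Q (row i X - row j X) (row i Y - row j Y).

Section Forms.
Variables (F : realFieldType) (n : nat).
Implicit Types (Q : 'M[F]_n) (u v w : 'rV[F]_n).

Lemma bformE Q u v : bform Q u v = \sum_k \sum_l u 0 k * Q k l * v 0 l.
Proof.
rewrite /bform mxE exchange_big; apply: eq_bigr => l _.
by rewrite !mxE mulr_suml.
Qed.

Lemma bformDl Q u v w : bform Q (u + v) w = bform Q u w + bform Q v w.
Proof. by rewrite /bform !mulmxDl mxE. Qed.

Lemma bformZl Q a u w : bform Q (a *: u) w = a * bform Q u w.
Proof. by rewrite /bform -!scalemxAl mxE. Qed.

Lemma bformDr Q u v w : bform Q w (u + v) = bform Q w u + bform Q w v.
Proof. by rewrite /bform linearD mulmxDr mxE. Qed.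

Lemma bformZr Q a u w : bform Q w (a *: u) = a * bform Q w u.
Proof. by rewrite /bform linearZ /= -scalemxAr mxE. Qed.

Lemma bform0l Q w : bform Q 0 w = 0.
Proof. by rewrite /bform !mul0mx mxE. Qed.

Lemma bform0r Q w : bform Q w 0 = 0.
Proof. by rewrite /bform linear0 mulmx0 mxE. Qed.

Lemma bform_suml (I : finType) Q (u : I -> 'rV[F]_n) w :
  bform Q (\sum_i u i) w = \sum_i bform Q (u i) w.
Proof.
exact: (big_morph (fun v => bform Q v w) (fun x y => bformDl Q x y w) (bform0l Q w)).
Qed.

Lemma bform_sumr (I : finType) Q (u : I -> 'rV[F]_n) w :
  bform Q w (\sum_i u i) = \sum_i bform Q w (u i).
Proof.
exact: (big_morph (bform Q w) (fun x y => bformDr Q x y w) (bform0r Q w)).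
Qed.

Lemma bformC Q u v : Q^T = Q -> bform Q u v = bform Q v u.
Proof.
move=> sQ; rewrite /bform -[in LHS](trmxK (u *m Q *m v^T)) mxE.
by rewrite !trmx_mul trmxK sQ mulmxA.
Qed.

(** Turns the Euclidean product with a velocity [v *m Q] into a [Q]-form, to which semidefiniteness
    applies. *)
Lemma bform1_mulmx Q u v : Q^T = Q -> bform 1%:M u (v *m Q) = bform Q u v.
Proof. by move=> sQ; rewrite /bform mulmx1 trmx_mul sQ mulmxA. Qed.

Lemma bform1E u v : bform 1%:M u v = \sum_k u 0 k * v 0 k.
Proof. by rewrite /bform mulmx1 mxE; apply: eq_bigr => k _; rewrite mxE. Qed.

Lemma psd1 : psd (1%:M : 'M[F]_n).
Proof.
split=> [|v]; first exact: trmx1.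
by rewrite bform1E sumr_ge0 // => k _; rewrite -expr2 sqr_ge0.
Qed.

(** Expand the form at [a *: u - v], which is nonnegative, and divide by [a]. *)
Lemma bform_young Q u v a : psd Q -> 0 < a ->
  2 * bform Q u v <= a * bform Q u u + a^-1 * bform Q v v.
Proof.
move=> [sQ pQ] a0; have := pQ (a *: u - v).
rewrite -scaleN1r !(bformDl, bformDr, bformZl, bformZr) (bformC v u sQ) => H.
have e : a * (a * bform Q u u + a^-1 * bform Q v v) = a * (a * bform Q u u) + bform Q v v.
  by rewrite mulrDr; congr (_ + _); rewrite mulrA mulfV ?mul1r // gt_eqF.
rewrite -(ler_pM2l a0) e; lra.
Qed.

Lemma bform_sub_le Q u v : psd Q ->
  bform Q (u - v) (u - v) <= 2 * bform Q u u + 2 * bform Q v v.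
Proof.
move=> [_ pQ]; have := pQ (u + v).
by rewrite -scaleN1r !(bformDl, bformDr, bformZl, bformZr); lra.
Qed.

(** Young's inequality with weight 1, summed over all pairs of indices. *)
Lemma bform_sum_le (p : nat) Q (v : 'I_p -> 'rV[F]_n) : psd Q ->
  bform Q (\sum_k v k) (\sum_k v k) <= p%:R * \sum_k bform Q (v k) (v k).
Proof.
move=> pQ; rewrite bform_suml.
pose s := \sum_k bform Q (v k) (v k).
have H k : 2 * bform Q (v k) (\sum_l v l) <= p%:R * bform Q (v k) (v k) + s.
  rewrite bform_sumr mulr_sumr.
  have -> : p%:R * bform Q (v k) (v k) + s = \sum_l (bform Q (v k) (v k) + bform Q (v l) (v l)).
    by rewrite big_split /= sumr_const card_ord mulr_natl.
  apply: ler_sum => l _; have := bform_young (v k) (v l) pQ ltr01.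
  by rewrite invr1 !mul1r.
have : \sum_k 2 * bform Q (v k) (\sum_l v l) <= \sum_k (p%:R * bform Q (v k) (v k) + s).
  by apply: ler_sum => k _.
rewrite -mulr_sumr big_split /= sumr_const card_ord -mulr_sumr -[s *+ p]mulr_natl -/s.
by lra.
Qed.

Variable p : nat.
Implicit Types (X Y : 'M[F]_(p, n)) (M : 'M[F]_p).

Lemma disagreement_ge0 Q X : psd Q -> 0 <= disagreement Q X X.
Proof. by move=> pQ; do 2!(apply: sumr_ge0 => ? _); apply: (proj2 pQ). Qed.

Lemma disagreement_ge Q X i j : psd Q ->
  bform Q (row i X - row j X) (row i X - row j X) <= disagreement Q X X.
Proof.
move=> pQ; rewrite /disagreement (bigD1 i) //= (bigD1 j) //= -addrA lerDl.
rewrite addr_ge0 // sumr_ge0 // => *; last apply: sumr_ge0 => *; exact: (proj2 pQ).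
Qed.

Lemma disagreementZD Q X Y a : Q^T = Q ->
  disagreement Q (X + a *: Y) (X + a *: Y) =
  disagreement Q X X + 2 * a * disagreement Q X Y + a ^+ 2 * disagreement Q Y Y.
Proof.
move=> sQ; rewrite /disagreement !mulr_sumr -!big_split; apply: eq_bigr => i _ /=.
rewrite !mulr_sumr -!big_split; apply: eq_bigr => j _ /=.
have -> : row i (X + a *: Y) - row j (X + a *: Y) =
    (row i X - row j X) + a *: (row i Y - row j Y).
  by apply/rowP => l; rewrite !mxE; ring.
move: (row i X - row j X) (row i Y - row j Y) => u v.
by rewrite !(bformDl, bformDr, bformZl, bformZr) (bformC v u sQ); ring.
Qed.

Lemma disagreement_sub_le Q X Y : psd Q ->
  disagreement Q (X - Y) (X - Y) <= 2 * disagreement Q X X + 2 * disagreement Q Y Y.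
Proof.
move=> pQ; rewrite /disagreement !mulr_sumr -!big_split; apply: ler_sum => i _ /=.
rewrite !mulr_sumr -!big_split; apply: ler_sum => j _ /=.
have -> : row i (X - Y) - row j (X - Y) = (row i X - row j X) - (row i Y - row j Y).
  by apply/rowP => l; rewrite !mxE; ring.
exact: bform_sub_le.
Qed.

Lemma disagreement1_mulmx Q X Y : Q^T = Q ->
  disagreement 1%:M X (Y *m Q) = disagreement Q X Y.
Proof.
move=> sQ; do 2!apply: eq_bigr => ? _.
by rewrite !row_mul -mulmxBl bform1_mulmx.
Qed.

(** With equal row sums, the coefficients [M i k - M j k] sum to zero over [k], so [row j X] can be
    subtracted from every [row k X]. One factor [p] comes from [bform_sum_le], the other from the
    sum over [i]. *)
Lemma disagreement_mulmx_le Q M X s eta : psd Q -> (forall i, \sum_j M i j = s) ->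
  (forall i j k, `|M i k - M j k| <= eta) ->
  disagreement Q (M *m X) (M *m X) <= (p%:R * eta) ^+ 2 * disagreement Q X X.
Proof.
move=> pQ Ms Me.
have e i j : row i (M *m X) - row j (M *m X) =
    \sum_k (M i k - M j k) *: (row k X - row j X).
  under eq_bigr do rewrite scalerBr.
  rewrite sumrB -scaler_suml sumrB !Ms subrr scale0r subr0.
  under [RHS]eq_bigr do rewrite scalerBl.
  rewrite sumrB !row_mul !mulmx_sum_row.
  by congr (_ - _); apply: eq_bigr => k _; rewrite mxE.
have H i j : bform Q (row i (M *m X) - row j (M *m X)) (row i (M *m X) - row j (M *m X)) <=
    (p%:R * eta ^+ 2) * \sum_k bform Q (row k X - row j X) (row k X - row j X).
  rewrite e; apply: le_trans (bform_sum_le _ pQ) _.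
  rewrite -mulrA ler_wpM2l ?ler0n // mulr_sumr; apply: ler_sum => k _.
  rewrite bformZl bformZr mulrA ler_wpM2r //; first exact: (proj2 pQ).
  by rewrite -expr2 -real_normK ?num_real // lerXn2r ?nnegrE // (le_trans _ (Me i j k)).
have -> : (p%:R * eta) ^+ 2 * disagreement Q X X =
    \sum_(i < p) (p%:R * eta ^+ 2) * disagreement Q X X.
  by rewrite sumr_const card_ord -mulr_natl; ring.
apply: ler_sum => i _.
rewrite /disagreement exchange_big mulr_sumr; apply: ler_sum => j _; exact: H.
Qed.

(** The constant depends on [M] alone and serves all [Q] at once. It is used for [G], with row sums
    0, and for powers of [A], with row sums 1. *)
Lemma disagreement_mulmx_bound M s : (forall i, \sum_j M i j = s) ->
  exists2 C, 0 <= C & forall Q X, psd Q ->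
    disagreement Q (M *m X) (M *m X) <= C * disagreement Q X X.
Proof.
move=> Ms; exists ((p%:R * (2 * \sum_i \sum_j `|M i j|)) ^+ 2); first exact: sqr_ge0.
move=> Q X pQ; apply: disagreement_mulmx_le pQ Ms _ => i j k.
have H i' : `|M i' k| <= \sum_i \sum_j `|M i j|.
  rewrite (bigD1 i') //= (bigD1 k) //= -addrA lerDl addr_ge0 //.
    by apply: sumr_ge0.
  by do 2!apply: sumr_ge0 => ? _.
by apply: le_trans (ler_normB _ _) _; rewrite mulr_natl mulr2n lerD.
Qed.

(* Discrete-time Lyapunov inequality for [A = 1 + h G], read at first order in [h]; the left-hand side is the derivative of a quadratic form along [G]. *)
Lemma disagreement_telescope Q (A G : 'M[F]_p) h X N : psd Q ->
  A = 1%:M + h *: G ->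
  2 * h * \sum_(k < N) disagreement Q (A ^+ k *m X) (A ^+ k *m (G *m X)) <=
  disagreement Q (A ^+ N *m X) (A ^+ N *m X) - disagreement Q X X.
Proof.
move=> pQ eA; elim: N => [|N IH]; first by rewrite big_ord0 mulr0 expr0 mul1mx subrr.
rewrite big_ord_recr /= mulrDr.
have -> : A ^+ N.+1 *m X = A ^+ N *m X + h *: (A ^+ N *m (G *m X)).
  by rewrite exprSr -mulmxA {2}eA mulmxDl mul1mx -scalemxAl mulmxDr -scalemxAr.
rewrite disagreementZD; last exact: (proj1 pQ).
have := mulr_ge0 (sqr_ge0 h) (disagreement_ge0 (A ^+ N *m (G *m X)) pQ).
by lra.
Qed.

End Forms.

(** * Powers of stochastic matrices and contraction towards consensus *)

Section Stochastic.
Variables (F : archiRealFieldType) (p : nat) (A : 'M[F]_p).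
Hypothesis A0 : forall i j, 0 <= A i j.
Hypothesis A1 : forall i, \sum_j A i j = 1.

Lemma stochastic_exp_ge0 N i j : 0 <= (A ^+ N) i j.
Proof.
elim: N i j => [|N IH] i j; first by rewrite expr0 mxE ler0n.
by rewrite exprS mxE sumr_ge0 // => k _; rewrite mulr_ge0.
Qed.

Lemma stochastic_exp_sum N i : \sum_j (A ^+ N) i j = 1.
Proof.
elim: N i => [|N IH] i.
  rewrite expr0 (bigD1 i) //= big1 ?addr0; first by rewrite mxE eqxx.
  by move=> j ji; rewrite mxE eq_sym (negPf ji).
under eq_bigr do rewrite exprS mxE.
rewrite exchange_big /= -(A1 i); apply: eq_bigr => k _.
by rewrite -mulr_sumr IH mulr1.
Qed.

(** Induction, using [(1 - d) * (1 + (N + 1) * d) <= 1 + N * d]; it forces the powers of [1 - d] to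
    be small in an archimedean field. *)
Lemma geometric_le_inv (d : F) N : 0 <= d <= 1 -> (1 - d) ^+ N * (1 + N%:R * d) <= 1.
Proof.
move=> /andP[d0 d1]; elim: N => [|N IH]; first by rewrite expr0 mul0r addr0 mulr1.
apply: le_trans IH; rewrite exprSr -mulrA ler_wpM2l ?exprn_ge0 ?subr_ge0 //.
have N0 : 0 <= N%:R :> F by rewrite ler0n.
have := mulr_ge0 (mulr_ge0 N0 d0) d0; have := mulr_ge0 d0 d0.
rewrite -natr1; lra.
Qed.

Lemma geometric_small (d eta : F) : 0 < d <= 1 -> 0 < eta -> exists N, (1 - d) ^+ N <= eta.
Proof.
move=> /andP[d0 d1] e0; exists (Num.bound (eta^-1 / d)).
set N := Num.bound _.
have HN : eta^-1 <= 1 + N%:R * d.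
  have : eta^-1 / d < N%:R by rewrite archi_boundP // mulr_ge0 // invr_ge0 ltW.
  rewrite ltr_pdivrMr // => H; lra.
have d01 : 0 <= d <= 1 by rewrite d1 ltW.
have q0 : 0 <= (1 - d) ^+ N by rewrite exprn_ge0 // subr_ge0.
have := le_trans (ler_wpM2l q0 HN) (geometric_le_inv N d01).
by rewrite ler_pdivrMr // mul1r.
Qed.

(** Every row of [B] gives weight at least [d] to the same entry [y k 0], so both ends of the
    enclosing interval move towards it by the fraction [d] of their distance. *)
Lemma stochastic_oscillation (B : 'M[F]_p) k d (y : 'cV[F]_p) lo hi :
  (forall i j, 0 <= B i j) -> (forall i, \sum_j B i j = 1) -> (forall i, d <= B i k) ->
  (forall i, lo <= y i 0 <= hi) ->
  exists lo' hi', hi' - lo' = (1 - d) * (hi - lo) /\ forall i, lo' <= (B *m y) i 0 <= hi'.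
Proof.
move=> B0 B1 Bd Hy.
exists (lo + d * (y k 0 - lo)), (hi - d * (hi - y k 0)); split; first by ring.
move=> i; rewrite mxE.
have /andP[ylo yhi] := Hy k.
have el : \sum_j B i j * y j 0 - lo = \sum_j B i j * (y j 0 - lo).
  under [RHS]eq_bigr do rewrite mulrBr.
  by rewrite sumrB -mulr_suml B1 mul1r.
have eh : hi - \sum_j B i j * y j 0 = \sum_j B i j * (hi - y j 0).
  under [RHS]eq_bigr do rewrite mulrBr.
  by rewrite sumrB -mulr_suml B1 mul1r.
have Hl : d * (y k 0 - lo) <= \sum_j B i j * y j 0 - lo.
  rewrite el (bigD1 k) //= -[leLHS]addr0 lerD ?ler_wpM2r ?subr_ge0 //.
  by apply: sumr_ge0 => j _; rewrite mulr_ge0 // subr_ge0; case/andP: (Hy j).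
have Hh : d * (hi - y k 0) <= hi - \sum_j B i j * y j 0.
  rewrite eh (bigD1 k) //= -[leLHS]addr0 lerD ?ler_wpM2r ?subr_ge0 //.
  by apply: sumr_ge0 => j _; rewrite mulr_ge0 // subr_ge0; case/andP: (Hy j).
by apply/andP; split; lra.
Qed.

Hypothesis Adiag : forall i, 0 < A i i.

(** A positive diagonal entry is a self-loop: a walk may wait at its start and so be lengthened at
    will. *)
Lemma stochastic_exp_gt0_le M N i j : (M <= N)%N -> 0 < (A ^+ M) i j -> 0 < (A ^+ N) i j.
Proof.
move=> /subnK <-; elim: (N - M)%N => [|m IH] // /IH H.
rewrite addSn exprS mxE (bigD1 i) //= ltr_pwDl ?mulr_gt0 //.
by apply: sumr_ge0 => k _; rewrite mulr_ge0 // stochastic_exp_ge0.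
Qed.

Lemma stochastic_exp_connect i k : connect (fun i j => 0 < A i j) i k ->
  exists N, 0 < (A ^+ N) i k.
Proof.
case/connectP => s; elim: s i => [|j s IH] i /=.
  by move=> _ ->; exists 0%N; rewrite expr0 mxE eqxx ltr01.
case/andP => Aij /IH H /H[N HN]; exists N.+1.
rewrite exprS mxE (bigD1 j) //= ltr_pwDl ?mulr_gt0 //.
by apply: sumr_ge0 => l _; rewrite mulr_ge0 // stochastic_exp_ge0.
Qed.

(** Each node has a walk to [k] of its own length; waiting brings all of them to the largest length
    [m]. The bound [d] is the least entry of column [k] of [A ^+ m], at most 1 because rows sum to
    1. *)
Lemma stochastic_exp_column k : (forall i, connect (fun i j => 0 < A i j) i k) ->
  exists m d, 0 < d <= 1 /\ forall i, d <= (A ^+ m) i k.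
Proof.
move=> Hk.
have /fin_all_exists[f Hf] : forall i, exists N, 0 < (A ^+ N) i k.
  by move=> i; apply: stochastic_exp_connect.
pose m := \max_i f i.
have Hm i : 0 < (A ^+ m) i k by apply: stochastic_exp_gt0_le (Hf i); apply: leq_bigmax.
case: (arg_minP (P := xpredT) (fun i => (A ^+ m) i k) (i0 := k) isT) => i0 _ Hi0.
exists m, ((A ^+ m) i0 k); split; last by move=> i; apply: Hi0.
rewrite Hm -(stochastic_exp_sum m i0) (bigD1 k) //= lerDl.
by apply: sumr_ge0 => j _; apply: stochastic_exp_ge0.
Qed.

(** Column [c] of a power is that power applied to a basis vector, whose entries lie in [[0, 1]];
    each application of [A ^+ m] shrinks the oscillation by [1 - d]. *)
Lemma stochastic_exp_contract k eta : (forall i, connect (fun i j => 0 < A i j) i k) ->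
  0 < eta -> exists N, forall i j c, `|(A ^+ N) i c - (A ^+ N) j c| <= eta.
Proof.
move=> Hk e0; have [m [d [d01 Hd]]] := stochastic_exp_column Hk.
have [N HN] := geometric_small d01 e0.
exists (m * N)%N => i j c.
have [lo [hi [Ehl H]]] : exists lo hi, hi - lo = (1 - d) ^+ N /\
    forall i, lo <= (A ^+ (m * N) *m (delta_mx c 0 : 'cV_p)) i 0 <= hi.
  elim: N {HN} => [|N [lo [hi [Ehl H]]]].
    exists 0, 1; split; first by rewrite subr0 expr0.
    by move=> l; rewrite muln0 expr0 mul1mx mxE ler0n lern1 leq_b1.
  have [lo' [hi' [E' H']]] := stochastic_oscillation
    (stochastic_exp_ge0 m) (stochastic_exp_sum m) Hd H.
  exists lo', hi'; split; first by rewrite E' Ehl exprS.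
  by move=> l; rewrite mulnS exprD -mulmxA.
have e l : (A ^+ (m * N) *m (delta_mx c 0 : 'cV_p)) l 0 = (A ^+ (m * N)) l c.
  by rewrite -colE mxE.
have := H i; have := H j; rewrite !e => /andP[? ?] /andP[? ?].
apply: le_trans HN; rewrite -Ehl ler_norml; apply/andP; split; lra.
Qed.

End Stochastic.

(** * Primitives of matrix-valued functions and of their disagreement *)

Lemma primitive_ler (u w f g : R -> R) (a b : R) : is_primitive u f -> is_primitive w g ->
  0 <= a -> a <= b -> (forall s, a <= s -> s <= b -> f s <= g s) ->
  u b - u a <= w b - w a.
Proof.
move=> Hu Hw /RleP Ha /RleP Hab Hfg; apply/RleP.
apply: primitive_le Hu Hw Ha Hab _ => s /RleP Hs /RleP Hs'.
by apply/RleP; apply: Hfg.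
Qed.

Lemma primitive_extr (u w f g : R -> R) : is_primitive u f ->
  (forall s, 0 <= s -> u s = w s) -> (forall s, 0 <= s -> f s = g s) -> is_primitive w g.
Proof.
by move=> H Huw Hfg; apply: (primitive_ext _ _ _ _ H) => s /RleP; [apply: Huw|apply: Hfg].
Qed.

Lemma primitive_sum (I : finType) (u f : I -> R -> R) :
  (forall i, is_primitive (u i) (f i)) ->
  is_primitive (fun t => \sum_i u i t) (fun t => \sum_i f i t).
Proof.
move=> H; elim: (index_enum I) => [|i s IH].
  apply: (primitive_extr (primitive_const 0)) => t _; by rewrite big_nil.
apply: (primitive_extr (primitive_plus _ _ _ _ (H i) IH)) => t _; by rewrite big_cons.
Qed.

(* [primitive_mult], [primitive_scal] and [primitive_plus] with the operations read in the MathComp ring structure of [R]. *)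
Lemma primitive_mulr (u w f g : R -> R) : is_primitive u f -> is_primitive w g ->
  is_primitive (fun t => u t * w t) (fun t => f t * w t + u t * g t).
Proof. exact: primitive_mult. Qed.

Lemma primitive_scaler (c : R) (u f : R -> R) : is_primitive u f ->
  is_primitive (fun t => c * u t) (fun t => c * f t).
Proof. exact: primitive_scal. Qed.

Lemma primitive_addr (u w f g : R -> R) : is_primitive u f -> is_primitive w g ->
  is_primitive (fun t => u t + w t) (fun t => f t + g t).
Proof. exact: primitive_plus. Qed.

Lemma primitive_subr (u w f g : R -> R) : is_primitive u f -> is_primitive w g ->
  is_primitive (fun t => u t - w t) (fun t => f t - g t).
Proof.
move=> Hu /(primitive_scaler (-1)) /(primitive_addr Hu) H.
by apply: (primitive_extr H) => s _; rewrite mulN1r.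
Qed.

Lemma primitive_mulmx m n k (M : 'M[R]_(m, n)) (Y Z : R -> 'M[R]_(n, k)) :
  (forall i j, is_primitive (fun s => Y s i j) (fun s => Z s i j)) ->
  forall i j, is_primitive (fun s => (M *m Y s) i j) (fun s => (M *m Z s) i j).
Proof.
move=> H i j.
apply: (primitive_extr (primitive_sum (fun l => primitive_scaler (M i l) (H l j)))) => s _;
by rewrite mxE.
Qed.

Lemma primitive_disagreement1 n p (Y Z : R -> 'M[R]_(p, n)) :
  (forall i j, is_primitive (fun s => Y s i j) (fun s => Z s i j)) ->
  is_primitive (fun s => disagreement 1%:M (Y s) (Y s))
    (fun s => 2 * disagreement 1%:M (Y s) (Z s)).
Proof.
move=> H.
have Hd i j k := primitive_subr (H i k) (H j k).
have Hs := primitive_sum (fun i => primitive_sum (fun j => primitive_sum (fun k =>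
  primitive_mulr (Hd i j k) (Hd i j k)))).
apply: (primitive_extr Hs) => s _.
  by do 2!apply: eq_bigr => ? _; rewrite bform1E; apply: eq_bigr => k _; rewrite !mxE.
rewrite mulr_sumr; apply: eq_bigr => i _; rewrite mulr_sumr; apply: eq_bigr => j _.
by rewrite bform1E mulr_sumr; apply: eq_bigr => k _; rewrite !mxE /=; ring.
Qed.

Lemma primitive_integrable_mul (f w g : R -> R) :
  (forall t, 0 <= t -> ex_RInt f 0 t) -> is_primitive w g ->
  is_primitive (fun t => RInt (fun s => f s * w s) 0 t) (fun s => f s * w s).
Proof.
move=> Hf Hw; apply: primitive_RInt => t Ht.
apply: (ex_RInt_mult_primitive _ _ _ _ _ _ _ Hw); first by split=> //; apply: Rle_refl.
by apply: Hf; apply/RleP.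
Qed.

(** Supplies the dissipated energy: the integrand is a finite sum of entries of [Q] times products
    of primitives, hence integrable. *)
Lemma disagreement_primitive n p (Q : R -> 'M[R]_n) (Y Z : R -> 'M[R]_(p, n)) :
  mx_Riemann_integrable Q ->
  (forall i j, is_primitive (fun s => Y s i j) (fun s => Z s i j)) ->
  exists S, is_primitive S (fun s => disagreement (Q s) (Y s) (Y s)).
Proof.
move=> HQ H.
have Hd i j k := primitive_subr (H i k) (H j k).
have Hi k l t : 0 <= t -> ex_RInt (fun s => Q s k l) 0 t by move=> t0; apply: HQ.
have Hs := primitive_sum (fun i => primitive_sum (fun j => primitive_sum (fun k =>
  primitive_sum (fun l =>
   primitive_integrable_mul (Hi k l) (primitive_mulr (Hd i j k) (Hd i j l)))))).
eexists; apply: (primitive_extr Hs) => [s _|s _]; first by reflexivity.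
apply: eq_bigr => i _; apply: eq_bigr => j _; rewrite bformE.
by do 2!apply: eq_bigr => ? _; rewrite !mxE /=; ring.
Qed.

Lemma mxRInt_sub n (Q : R -> 'M[R]_n) (a b : R) : mx_Riemann_integrable Q ->
  0 <= a -> a <= b -> mxRInt Q a b = mxRInt Q 0 b - mxRInt Q 0 a.
Proof.
move=> HQ a0 ab; apply/matrixP => i j; rewrite !mxE.
have Ha : ex_RInt (fun s => Q s i j) 0 a by apply: HQ.
have Hab : ex_RInt (fun s => Q s i j) a b by apply: HQ.
rewrite -(RInt_Chasles _ _ _ _ Ha Hab).
have -> x y : plus x y = x + y :> R by [].
by rewrite addrC addKr.
Qed.

Lemma primitive_bform n (Q : R -> 'M[R]_n) (u v : 'rV[R]_n) : mx_Riemann_integrable Q ->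
  is_primitive (fun t => bform (mxRInt Q 0 t) u v) (fun s => bform (Q s) u v).
Proof.
move=> HQ.
have Hp k l : is_primitive (fun t => RInt (fun s => Q s k l) 0 t) (fun s => Q s k l).
  by apply: primitive_RInt => t /RleP t0; apply: HQ.
have Hs := primitive_sum (fun k => primitive_sum (fun l =>
  primitive_scaler (u 0 k * v 0 l) (Hp k l))).
apply: (primitive_extr Hs) => s _; rewrite bformE;
  by do 2!apply: eq_bigr => ? _; rewrite ?mxE; apply: mulrAC.
Qed.

Lemma bform_mxRInt n (Q : R -> 'M[R]_n) (u v : 'rV[R]_n) (a b : R) :
  mx_Riemann_integrable Q -> 0 <= a -> a <= b ->
  bform (mxRInt Q a b) u v = bform (mxRInt Q 0 b) u v - bform (mxRInt Q 0 a) u v.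
Proof.
by move=> HQ a0 ab; rewrite mxRInt_sub // /bform mulmxBr mulmxBl !mxE.
Qed.

Lemma primitive_disagreement n p (Q : R -> 'M[R]_n) (Y : 'M[R]_(p, n)) :
  mx_Riemann_integrable Q ->
  is_primitive (fun t => disagreement (mxRInt Q 0 t) Y Y) (fun s => disagreement (Q s) Y Y).
Proof. by move=> HQ; do 2!apply: primitive_sum => ?; apply: primitive_bform. Qed.

Lemma disagreement_mxRInt n p (Q : R -> 'M[R]_n) (Y : 'M[R]_(p, n)) (a b : R) :
  mx_Riemann_integrable Q -> 0 <= a -> a <= b ->
  disagreement (mxRInt Q a b) Y Y =
  disagreement (mxRInt Q 0 b) Y Y - disagreement (mxRInt Q 0 a) Y Y.
Proof.
move=> HQ a0 ab; rewrite /disagreement -sumrB; apply: eq_bigr => i _.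
by rewrite -sumrB; apply: eq_bigr => j _; rewrite bform_mxRInt.
Qed.

(** * From [opnorm2] and [sigma_min] to quadratic-form inequalities *)

Lemma vnorm2_sqr n (v : 'cV[R]_n) : vnorm2 v ^+ 2 = bform 1%:M v^T v^T.
Proof.
rewrite bform1E /vnorm2 sqr_sqrtr; last by apply: sumr_ge0 => k _; apply: sqr_ge0.
by apply: eq_bigr => k _; rewrite mxE expr2.
Qed.

Lemma bform1_vnorm2 n (v : 'rV[R]_n) : bform 1%:M v v = vnorm2 v^T ^+ 2.
Proof. by rewrite vnorm2_sqr trmxK. Qed.

Lemma vnorm2_ge0 n (v : 'cV[R]_n) : 0 <= vnorm2 v.
Proof. exact: sqrtr_ge0. Qed.

(** Reduces quadratic inequalities to the unit vectors over which [opnorm2] and [sigma_min] range;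
    the case [a = 0] covers the zero vector, also when no unit vector exists. *)
Lemma row_unit_decomposition n (v : 'rV[R]_n) :
  exists a (u : 'rV[R]_n), v = a *: u /\ (a = 0 \/ vnorm2 u^T = 1).
Proof.
have [v0|v0] := eqVneq (vnorm2 v^T) 0.
  exists 0, 0; split; last by left.
  have H : \sum_k v 0 k * v 0 k = 0.
    by rewrite -bform1E bform1_vnorm2 v0 expr0n.
  rewrite scaler0; apply/rowP => k; rewrite mxE; apply/eqP.
  move/eqP: H; rewrite psumr_eq0 => [/allP /(_ k (mem_index_enum k))|l _].
    by rewrite /= mulf_eq0 orbb.
  by rewrite -expr2 sqr_ge0.
exists (vnorm2 v^T), ((vnorm2 v^T)^-1 *: v).
rewrite scalerA mulfV // scale1r; split=> //; right.
apply/eqP; rewrite -(eqrXn2 (n := 2)) ?vnorm2_ge0 // vnorm2_sqr trmxK bformZl bformZr.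
rewrite bform1_vnorm2 expr1n.
by rewrite expr2 mulrA -invfM -expr2 mulVf // expf_neq0.
Qed.

(** [sup] dominates its set only if the set is bounded above. Here [A *m v] combines the columns of
    [A] with coefficients of absolute value at most 1. *)
Lemma vnorm2_mulmx_ubound n (A : 'M[R]_n) :
  has_ubound [set vnorm2 (A *m v) | v in [set v : 'cV[R]_n | vnorm2 v = 1]]%classic.
Proof.
pose C := n%:R * \sum_l bform 1%:M (row l A^T) (row l A^T).
exists (Num.sqrt C) => _ [v /= v1 <-].
rewrite -(ger0_norm (vnorm2_ge0 _)) -sqrtr_sqr ler_wsqrtr // vnorm2_sqr trmx_mul mulmx_sum_row.
apply: le_trans (bform_sum_le _ (psd1 _ _)) _; rewrite ler_wpM2l ?ler0n //.
apply: ler_sum => l _; rewrite bformZl bformZr mulrA ler_piMl ?(proj2 (psd1 _ _)) //.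
have := vnorm2_sqr v; rewrite v1 expr1n bform1E => ->.
by rewrite (bigD1 l) //= lerDl; apply: sumr_ge0 => k _; rewrite -expr2 sqr_ge0.
Qed.

Lemma in_Qbar_psd n (Q : 'M[R]_n) : in_Qbar Q -> psd Q.
Proof.
move=> [sQ [pQ _]]; split=> // v.
by have := pQ v^T; rewrite trmxK.
Qed.

(** For a unit vector [u], Young's inequality bounds twice the product of [u] and [u *m Q] by the
    sum of their squared norms, which is at most 2. *)
Lemma in_Qbar_bform_le n (Q : 'M[R]_n) (v : 'rV[R]_n) : in_Qbar Q ->
  bform Q v v <= bform 1%:M v v.
Proof.
move=> HQ; have [sQ _] := in_Qbar_psd HQ; case: HQ => _ [_ nQ].
have [a [u [-> [->|u1]]]] := row_unit_decomposition v.
  by rewrite scale0r !bform0l.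
rewrite !bformZl !bformZr !mulrA ler_wpM2l -?expr2 ?sqr_ge0 //.
have Hu : bform 1%:M u u = 1 by rewrite bform1_vnorm2 u1 expr1n.
have HQu : bform 1%:M (u *m Q) (u *m Q) <= 1.
  have -> : u *m Q = (Q *m u^T)^T by rewrite trmx_mul trmxK sQ.
  rewrite -vnorm2_sqr expr_le1 ?vnorm2_ge0 //; apply: le_trans nQ.
  by apply: ub_le_sup; [exact: vnorm2_mulmx_ubound|exists u^T].
have := bform_young u (u *m Q) (psd1 _ _) ltr01.
by rewrite bform1_mulmx // Hu invr1; lra.
Qed.

Lemma sigma_min_bform_le n (K : 'M[R]_n) (eps : R) (v : 'rV[R]_n) : 0 < eps ->
  K^T = K -> eps <= sigma_min K ->
  eps ^+ 2 * bform 1%:M v v <= bform 1%:M (v *m K) (v *m K).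
Proof.
move=> e0 sK eK.
have [a [u [-> [->|u1]]]] := row_unit_decomposition v.
  by rewrite scale0r mul0mx !bform0l mulr0.
rewrite -scalemxAl !bformZl !bformZr.
have Hu : bform 1%:M u u = 1 by rewrite bform1_vnorm2 u1 expr1n.
suff H : eps ^+ 2 <= bform 1%:M (u *m K) (u *m K).
  have := ler_wpM2l (sqr_ge0 a) H; rewrite Hu; lra.
have -> : u *m K = (K *m u^T)^T by rewrite trmx_mul trmxK sK.
rewrite -vnorm2_sqr lerXn2r ?nnegrE ?vnorm2_ge0 // ?(ltW e0) //.
apply: le_trans eK _; apply: ge_inf; last by exists u^T.
by exists 0 => _ [w _ <-]; apply: vnorm2_ge0.
Qed.

(* Cauchy-Schwarz for [K] bounds [|K v|^2] by [T * bform K v v], which replaces the spectral theorem. *)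
Lemma sigma_min_psd n (K : 'M[R]_n) (eps T : R) (v : 'rV[R]_n) : 0 < eps -> 0 < T ->
  psd K -> (forall u, bform K u u <= T * bform 1%:M u u) -> eps <= sigma_min K ->
  eps ^+ 2 / T * bform 1%:M v v <= bform K v v.
Proof.
move=> e0 T0 pK KT eK.
have sK := proj1 pK.
have H1 := sigma_min_bform_le v e0 sK eK.
have H2 : bform K v (v *m K) = bform 1%:M (v *m K) (v *m K).
  by rewrite bformC // -bform1_mulmx.
have Ti0 : 0 < T^-1 by rewrite invr_gt0.
have := bform_young (v *m K) v pK Ti0; rewrite (bformC _ _ sK) H2 invrK => H3.
have := ler_wpM2l (ltW Ti0) (KT (v *m K)); rewrite mulrA mulVf ?gt_eqF // mul1r => H4.
have H5 : bform 1%:M (v *m K) (v *m K) <= T * bform K v v by lra.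
by rewrite mulrAC ler_pdivrMr // [leRHS]mulrC; apply: le_trans H1 H5.
Qed.

Lemma psd_mxRInt n (Q : R -> 'M[R]_n) (a b : R) : mx_Riemann_integrable Q ->
  (forall s, 0 <= s -> psd (Q s)) -> 0 <= a -> a <= b -> psd (mxRInt Q a b).
Proof.
move=> HQ pQ a0 ab; split.
  apply/matrixP => i j; rewrite !mxE; apply: RInt_ext => s.
  rewrite Rmin_left ?Rmax_right; try by apply/RleP.
  move=> [/Rlt_le/RleP sa _].
  have [sQ _] := pQ s (le_trans a0 sa).
  by rewrite -[in LHS]sQ mxE.
move=> v; rewrite bform_mxRInt //.
have := primitive_ler (primitive_const 0) (primitive_bform v v HQ) a0 ab.
rewrite subrr; apply => s sa _.
exact: (proj2 (pQ s (le_trans a0 sa))).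
Qed.

Lemma mxRInt_bform_le n (Q : R -> 'M[R]_n) (a b : R) (v : 'rV[R]_n) :
  mx_Riemann_integrable Q ->
  (forall s, 0 <= s -> bform (Q s) v v <= bform 1%:M v v) -> 0 <= a -> a <= b ->
  bform (mxRInt Q a b) v v <= (b - a) * bform 1%:M v v.
Proof.
move=> HQ H a0 ab; rewrite bform_mxRInt //.
have := primitive_ler (primitive_bform v v HQ) (primitive_linear (bform 1%:M v v)) a0 ab.
have -> x y : Rmult x y = x * y by [].
rewrite -mulrBr [leRHS]mulrC; apply => s sa _.
exact: (H s (le_trans a0 sa)).
Qed.

Lemma geometric_decay_expr (V : R -> R) (T rho : R) : 0 < T -> rho < 1 ->
  (forall t, 0 <= t -> 0 <= V t) ->
  (forall s t, 0 <= s -> s <= t -> V t <= V s) ->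
  (forall t, 0 <= t -> V (t + T) <= rho * V t) ->
  exists c alpha : R, 0 < c /\ 0 < alpha /\
    forall t : R, 0 <= t -> V t <= c * exp (- alpha * t).
Proof.
move=> /RltP T0 /RltP rho1 V0 Vm Vd.
case: (geometric_decay_exp V T rho T0 rho1).
- by move=> t /RleP t0; apply/RleP; apply: V0.
- by move=> s t /RleP s0 /RleP st; apply/RleP; apply: Vm.
- by move=> t /RleP t0; apply/RleP; apply: Vd.
move=> c [al [/RltP c0 [/RltP al0 H]]]; exists c, al; do 2!split=> //.
by move=> t /RleP t0; apply/RleP; apply: H.
Qed.

(** * The stochastic matrix of an interconnection *)

Lemma interconnection_row_sum p (G : 'M[R]_p) i : ct_interconnection G ->
  \sum_j G i j = 0.
Proof. by move=> [_ GD]; rewrite (bigD1 i) //= GD addNr. Qed.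

(* [1 + h G] is a stochastic matrix with positive diagonal when [h] is small, so its powers contract towards consensus. *)
Lemma interconnection_contract n p (G : 'M[R]_p) : ct_interconnection G ->
  connected_interconnection G ->
  exists h (A : 'M[R]_p) N, [/\ 0 < h, A = 1%:M + h *: G,
    forall k i, \sum_j (A ^+ k) i j = 1 &
    forall (Q : 'M[R]_n) (X : 'M[R]_(p, n)), psd Q ->
      disagreement Q (A ^+ N *m X) (A ^+ N *m X) <= 2^-1 * disagreement Q X X].
Proof.
move=> ctG [k Hk]; have [G0 GD] := ctG.
have Gdiag i : G i i <= 0.
  by rewrite GD oppr_le0; apply: sumr_ge0 => j ji; apply: G0; rewrite eq_sym.
(* With [h = c^-1], every [h * - G i i] is below 1, so the diagonal of [A] stays positive. *)
pose c := 1 + \sum_i - G i i.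
have c0 : 0 < c.
  by rewrite /c ltr_pwDl // sumr_ge0 // => i _; rewrite oppr_ge0.
have h0 : 0 < c^-1 by rewrite invr_gt0.
pose A : 'M[R]_p := 1%:M + c^-1 *: G.
have Adiag i : 0 < A i i.
  rewrite /A !mxE eqxx -[c^-1 * _]opprK subr_gt0 -mulrN mulrC ltr_pdivrMr // mul1r.
  rewrite /c (bigD1 i) //= addrCA ltrDl ltr_pwDl // sumr_ge0 // => j _.
  by rewrite oppr_ge0.
have Aoff i j : i != j -> A i j = c^-1 * G i j.
  by move=> ij; rewrite /A !mxE (negPf ij) mulr0n add0r.
have A0 i j : 0 <= A i j.
  have [<-|ij] := eqVneq i j; first exact: ltW.
  by rewrite Aoff // mulr_ge0 ?G0 // ltW.
have A1 i : \sum_j A i j = 1.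
  under eq_bigr do rewrite !mxE.
  rewrite big_split /= -mulr_sumr interconnection_row_sum // mulr0 addr0.
  rewrite (bigD1 i) //= eqxx big1 ?addr0 // => j ji.
  by rewrite eq_sym (negPf ji).
have con i : connect (fun i j => 0 < A i j) i k.
  have [->|ik] := eqVneq i k; first exact: connect0.
  apply: connect_sub (Hk i ik) => x y xy; apply: connect1.
  (* Edges are never loops since [G x x <= 0], so each edge is an off-diagonal positive entry of
     [A]. *)
  have xny : x != y.
    by apply: contraTneq xy => <-; rewrite /edge -leNgt.
  by rewrite Aoff // mulr_gt0.
have p0 : 0 < p%:R :> R by rewrite ltr0n; apply: leq_ltn_trans (ltn_ord k).
(* This tolerance makes the factor [(p%:R * eta) ^+ 2] equal to 1/4, below the required 1/2. *)
have e0 : 0 < (2 * p%:R)^-1 :> R by rewrite invr_gt0 mulr_gt0.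
have [N HN] := stochastic_exp_contract A0 A1 Adiag con e0.
exists c^-1, A, N; split=> //; first exact: stochastic_exp_sum.
move=> Q X pQ.
apply: le_trans (disagreement_mulmx_le X pQ (stochastic_exp_sum A1 N) HN) _.
rewrite ler_wpM2r ?disagreement_ge0 // invfM mulrCA mulfV ?gt_eqF // mulr1.
by rewrite expr2; lra.
Qed.

(** * Lyapunov derivative, dissipated energy and displacement along a solution *)

Section Dynamics.
Variables (n p : nat) (G : 'M[R]_p) (Q : R -> 'M[R]_n) (X : R -> 'M[R]_(p, n)).
Hypothesis X_sol : forall i k,
  is_primitive (fun s => X s i k) (fun s => (G *m X s *m Q s) i k).
Hypothesis Q_int : mx_Riemann_integrable Q.
Hypothesis Q_psd : forall s, 0 <= s -> psd (Q s).
Hypothesis Q_le1 : forall s u, 0 <= s -> bform (Q s) u u <= bform 1%:M u u.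

Lemma lyapunov_primitive (A : 'M[R]_p) N :
  is_primitive (fun s => \sum_(k < N) disagreement 1%:M (A ^+ k *m X s) (A ^+ k *m X s))
    (fun s => 2 * \sum_(k < N) disagreement (Q s) (A ^+ k *m X s) (A ^+ k *m (G *m X s))).
Proof.
have Hk (k : 'I_N) := primitive_disagreement1 (primitive_mulmx (A ^+ k) X_sol).
apply: (primitive_extr (primitive_sum Hk)) => s s0 //.
rewrite mulr_sumr; apply: eq_bigr => k _; rewrite mulmxA.
by rewrite disagreement1_mulmx //; apply: (proj1 (Q_psd s0)).
Qed.

Variable S : R -> R.
Hypothesis S_prim : is_primitive S (fun s => disagreement (Q s) (X s) (X s)).
Variable CG : R.
Hypothesis CG0 : 0 <= CG.
Hypothesis CGP : forall Q0 Y, @psd R n Q0 ->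
  disagreement Q0 (G *m Y) (G *m Y) <= CG * disagreement Q0 Y Y.

Lemma energy_nondecreasing a b : 0 <= a -> a <= b -> S a <= S b.
Proof.
move=> a0 ab; have := primitive_ler (primitive_const 0) S_prim a0 ab.
rewrite subrr subr_ge0; apply => s sa _.
by apply: disagreement_ge0; apply: Q_psd; apply: le_trans sa.
Qed.

(* With [d] the displacement of [x_i - x_j] over [t, s], Young's inequality applied to [|d|^2], the integral of [bform Q d (y_i - y_j)], avoids the Cauchy-Schwarz inequality for integrals. *)
Lemma displacement_le t s T : 0 < T -> 0 <= t -> t <= s -> s <= t + T ->
  disagreement 1%:M (X s - X t) (X s - X t) <= (p * p)%:R * (T * (CG * (S (t + T) - S t))).
Proof.
move=> T0 t0 ts sT.
suff H i j : bform 1%:M (row i (X s - X t) - row j (X s - X t))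
    (row i (X s - X t) - row j (X s - X t)) <= T * (CG * (S (t + T) - S t)).
  have -> x : (p * p)%:R * x = \sum_(i < p) \sum_(j < p) x :> R.
    by rewrite !sumr_const !card_ord -mulrnA mulr_natl.
  by do 2!apply: ler_sum => ? _.
set d := row i _ - row j _.
(* With [d] frozen, the increment of [U] from [t] to [s] is the squared norm of [d]. *)
pose U tau := \sum_k d 0 k * (X tau i k - X tau j k).
have HU : is_primitive (fun tau => 2 * U tau)
    (fun tau => 2 * bform (Q tau) d (row i (G *m X tau) - row j (G *m X tau))).
  have H := primitive_scaler 2 (primitive_sum (fun k =>
    primitive_scaler (d 0 k) (primitive_subr (X_sol i k) (X_sol j k)))).
  apply: (primitive_extr H) => tau tau0 //; congr (_ * _).
  rewrite -bform1_mulmx; last exact: (proj1 (Q_psd tau0)).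
  by rewrite bform1E mulmxBl -!row_mul; apply: eq_bigr => k _; rewrite !mxE.
(* Young's weight [T^-1] is chosen so that the first term grows by at most [bform 1%:M d d] over
   [[t, s]] and is absorbed by the left-hand side. *)
pose W tau := T^-1 * bform 1%:M d d * tau + T * CG * S tau.
have HW : is_primitive W (fun tau => T^-1 * bform 1%:M d d +
    T * CG * disagreement (Q tau) (X tau) (X tau)).
  exact: (primitive_addr (primitive_linear _) (primitive_scaler _ S_prim)).
have Ti0 : 0 < T^-1 by rewrite invr_gt0.
have := primitive_ler HU HW t0 ts.
have -> : 2 * U s - 2 * U t = 2 * bform 1%:M d d.
  rewrite -mulrBr; congr (_ * _); rewrite /U -sumrB bform1E.
  by apply: eq_bigr => k _; rewrite !mxE; ring.
have d0 := proj2 (@psd1 R n) d.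
have SS : S s - S t <= S (t + T) - S t.
  by rewrite lerD2r energy_nondecreasing // (le_trans t0 ts).
have H1 : T^-1 * bform 1%:M d d * (s - t) <= bform 1%:M d d.
  rewrite mulrAC ler_piMl // mulrC ler_pdivrMr // mul1r; lra.
have H2 := ler_wpM2l (mulr_ge0 (ltW T0) CG0) SS.
suff H3 : forall tau, t <= tau -> tau <= s ->
    2 * bform (Q tau) d (row i (G *m X tau) - row j (G *m X tau)) <=
    T^-1 * bform 1%:M d d + T * CG * disagreement (Q tau) (X tau) (X tau).
  by move=> /(_ H3); rewrite /W; lra.
move=> tau tta _; have tau0 := le_trans t0 tta.
have := bform_young d (row i (G *m X tau) - row j (G *m X tau)) (Q_psd tau0) Ti0.
move/le_trans; apply; rewrite invrK -mulrA.
apply: lerD; first by rewrite ler_wpM2l ?(ltW Ti0) ?Q_le1.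
rewrite ler_wpM2l ?(ltW T0) //; apply: le_trans (CGP _ (Q_psd tau0)).
exact: disagreement_ge (Q_psd tau0).
Qed.

Lemma energy_lower_bound c t T : 0 < T -> 0 <= t ->
  (forall u, c * bform 1%:M u u <= bform (mxRInt Q t (t + T)) u u) ->
  c * disagreement 1%:M (X t) (X t) <=
  (2 + 2 * (T * ((p * p)%:R * (T * CG)))) * (S (t + T) - S t).
Proof.
move=> T0 t0 Hc.
have tT : t <= t + T by rewrite lerDl ltW.
apply: (@le_trans _ _ (disagreement (mxRInt Q t (t + T)) (X t) (X t))).
  rewrite /disagreement mulr_sumr; apply: ler_sum => i _.
  by rewrite mulr_sumr; apply: ler_sum => j _; apply: Hc.
rewrite disagreement_mxRInt //.
pose D := (p * p)%:R * (T * (CG * (S (t + T) - S t))).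
have HW : is_primitive (fun s => 2 * S s + 2 * D * s)
    (fun s => 2 * disagreement (Q s) (X s) (X s) + 2 * D).
  exact: (primitive_addr (primitive_scaler _ S_prim) (primitive_linear _)).
have := primitive_ler (primitive_disagreement (X t) Q_int) HW t0 tT.
suff H s : t <= s -> s <= t + T -> disagreement (Q s) (X t) (X t) <=
    2 * disagreement (Q s) (X s) (X s) + 2 * D.
  by move/(_ H) => /le_trans; apply; rewrite /D; lra.
move=> ts sT; have s0 := le_trans t0 ts.
rewrite -{1 2}[X t](subKr (X s)).
apply: le_trans (disagreement_sub_le _ _ (Q_psd s0)) _.
rewrite lerD2l ler_wpM2l //; apply: le_trans (displacement_le T0 t0 ts sT).
by do 2!apply: ler_sum => ? _; apply: Q_le1.
Qed.

End Dynamics.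

(** * Exponential decay of the disagreement and synchronization *)

Lemma disagreement_decay n p (G : 'M[R]_p) (Q : R -> 'M[R]_n) (X : R -> 'M[R]_(p, n)) :
  ct_interconnection G -> connected_interconnection G ->
  (forall t : R, 0 <= t -> in_Qbar (Q t)) ->
  mx_Riemann_integrable Q -> persistently_exciting Q ->
  (forall i k, is_primitive (fun s => X s i k) (fun s => (G *m X s *m Q s) i k)) ->
  exists c alpha : R, 0 < c /\ 0 < alpha /\
    forall t : R, 0 <= t -> disagreement 1%:M (X t) (X t) <= c * exp (- alpha * t).
Proof.
move=> ctG conG HQ intQ [eps [T [e0 [T0 HPE]]]] X_sol.
have Q_psd s : 0 <= s -> psd (Q s) by move=> s0; apply: in_Qbar_psd; apply: HQ.
have Q_le1 s u : 0 <= s -> bform (Q s) u u <= bform 1%:M u u.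
  by move=> s0; apply: in_Qbar_bform_le; apply: HQ.
have [h [A [N [h0 eA Asum AN]]]] := interconnection_contract n ctG conG.
have [CG CG0 CGP] := disagreement_mulmx_bound n (fun i => interconnection_row_sum i ctG).
have [S S_prim] := disagreement_primitive intQ X_sol.
pose V Y : R := \sum_(k < N) disagreement 1%:M (A ^+ k *m Y) (A ^+ k *m Y : 'M[R]_(p, n)).
have V_ge0 Y : 0 <= V Y by apply: sumr_ge0 => k _; apply: disagreement_ge0 (psd1 _ _).
have V_ge Y : disagreement 1%:M Y Y <= V Y.
  (* If [N = 0], then [V] is an empty sum, but contraction by 1/2 under the identity forces the
     disagreement to vanish. *)
  rewrite /V; case: (N) AN => [|m] AN.
    have := AN _ Y (psd1 _ _); rewrite expr0 mul1mx big_ord0.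
    by have := disagreement_ge0 Y (psd1 R n); lra.
  rewrite big_ord_recl expr0 mul1mx lerDl; apply: sumr_ge0 => k _.
  exact: disagreement_ge0 (psd1 _ _).
have [CV CV0 V_le] : exists2 CV, 0 < CV & forall Y, V Y <= CV * disagreement 1%:M Y Y.
  have /fin_all_exists[f Hf] : forall k : 'I_N, exists C, 0 <= C /\
      forall Y : 'M[R]_(p, n), disagreement 1%:M (A ^+ k *m Y) (A ^+ k *m Y) <=
         C * disagreement 1%:M Y Y.
    move=> k; have [C C0 HC] := disagreement_mulmx_bound n (Asum k).
    by exists C; split=> // Y; apply: HC (psd1 _ _).
  exists (1 + \sum_k f k).
    by rewrite ltr_pwDl // sumr_ge0 // => k _; have [] := Hf k.
  move=> Y; rewrite mulrDl mul1r ler_wpDl ?disagreement_ge0 //; first exact: psd1.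
  by rewrite mulr_suml; apply: ler_sum => k _; have [_] := Hf k.
have V_prim := lyapunov_primitive X_sol Q_psd A N.
(* Telescoping and contraction give [2 * h * x <= - y / 2], so the derivative [2 * x] of [V] is at
   most [- (2 * b) * y]. *)
pose b := (4 * h)^-1.
have b0 : 0 < b by rewrite /b invr_gt0 mulr_gt0.
have V_dec s t : 0 <= s -> s <= t -> V (X t) - V (X s) <= - (2 * b) * S t - - (2 * b) * S s.
  move=> s0 st.
  apply: (primitive_ler V_prim (primitive_scaler _ S_prim) s0 st) => tau stau _.
  have pQ := Q_psd _ (le_trans s0 stau).
  have := disagreement_telescope (X tau) N pQ eA.
  have := AN _ (X tau) pQ.
  set x := \sum_(k < N) _; set y := disagreement _ (X tau) _ => H1 H2.
  have : 2 * h * x <= - (2^-1 * y) by lra.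
  have -> : 2 * x = (2 * b) * (2 * (2 * h * x)).
    by rewrite /b; field; rewrite gt_eqF.
  have b2 : 0 < 2 * b by lra.
  move=> H3; rewrite mulNr -mulrN ler_wpM2l ?(ltW b2) //; lra.
have S_mono := energy_nondecreasing Q_psd S_prim.
pose c0 := eps ^+ 2 / T.
have c00 : 0 < c0 by rewrite /c0 divr_gt0 // exprn_gt0.
pose kap := 2 + 2 * (T * ((p * p)%:R * (T * CG))).
have kap0 : 0 < kap.
  rewrite /kap ltr_pwDl // !mulr_ge0 ?ler0n // ltW //.
have HS t : 0 <= t -> c0 * disagreement 1%:M (X t) (X t) <= kap * (S (t + T) - S t).
  move=> t0; apply: energy_lower_bound => // u.
  have tT : t <= t + T by rewrite lerDl ltW.
  apply: sigma_min_psd => //; [exact: psd_mxRInt| |exact: HPE].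
  move=> v; have := mxRInt_bform_le intQ (fun s => Q_le1 s v) t0 tT.
  by rewrite addrAC subrr add0r.
(* Over one period [V] loses [2 * b] times the energy increment, which is at least [c0 / kap] times
   the disagreement, itself at least [V / CV]. *)
pose rho := 1 - 2 * b * (c0 / (kap * CV)).
have rho1 : rho < 1.
  have kC : 0 < c0 / (kap * CV) by apply: divr_gt0 => //; apply: mulr_gt0.
  by have := mulr_gt0 b0 kC; rewrite /rho; lra.
have [||t t0|c [al [c_gt0 [al0 Hc]]]] := @geometric_decay_expr (fun t => V (X t)) T rho T0 rho1.
- by [].
- move=> s t s0 st; have := V_dec s t s0 st.
  have := ler_wpM2l (ltW b0) (S_mono s t s0 st); lra.
- have tT : t <= t + T by rewrite lerDl ltW.
  have H1 := V_dec t (t + T) t0 tT.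
  have H2 : c0 / (kap * CV) * V (X t) <= S (t + T) - S t.
    rewrite mulrAC ler_pdivrMr ?mulr_gt0 //.
    have := ler_wpM2l (ltW CV0) (HS t t0).
    have := ler_wpM2l (ltW c00) (V_le (X t)); lra.
  have b2 : 0 <= 2 * b by lra.
  have := ler_wpM2l b2 H2; rewrite /rho; lra.
by exists c, al; do 2!split=> //; move=> t t0; apply: le_trans (V_ge _) (Hc t t0).
Qed.

Theorem theorem5 (n p : nat) (G : 'M[R]_p) (Q : R -> 'M[R]_n)
  (r : 'cV[R]_p) (x : 'I_p -> R -> 'cV[R]_n) :
  ct_interconnection G ->
  connected_interconnection G ->
  (forall t : R, 0 <= t -> in_Qbar (Q t)) ->
  mx_Riemann_integrable Q ->
  persistently_exciting Q ->
  r^T *m G = 0 ->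
  \sum_(j < p) r j 0 = 1 ->
  is_solution G Q x ->
  exp_synchronize x (fun _ => \sum_(j < p) r j 0 *: x j 0).
Proof.
move=> ctG conG HQ intQ PE rG r1 sol.
pose X s : 'M[R]_(p, n) := \matrix_(i, k) x i s k 0.
have X_sol i k : is_primitive (fun s => X s i k) (fun s => (G *m X s *m Q s) i k).
  have H : is_primitive (fun s => x i s k 0) (fun s => cons_rhs G Q x i s k 0).
    by move=> t /RleP t0; apply: sol.
  apply: (primitive_extr H) => s s0; first by rewrite mxE.
  have [sQ _] := in_Qbar_psd (HQ s s0).
  have -> : G *m X s *m Q s = (Q s *m (G *m X s)^T)^T by rewrite trmx_mul trmxK sQ.
  rewrite /cons_rhs [RHS]mxE !mxE; apply: eq_bigr => l _; congr (_ * _).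
  (* The diagonal entry of [G] collects the terms in [- x i], so the coupling sum is row [i] of
     [G *m X s]. *)
  rewrite !mxE summxE [RHS](bigD1 i) //= (proj2 ctG) mulNr mulr_suml -sumrN -big_split /=.
  by apply: eq_bigr => j _; rewrite !mxE; ring.
have [c [al [c0 [al0 Hc]]]] := disagreement_decay ctG conG HQ intQ PE X_sol.
have X_mean t : 0 <= t -> r^T *m X t = r^T *m X 0.
  move=> t0; apply/matrixP => i k.
  have H := primitive_mulmx r^T X_sol i k.
  have H0 : is_primitive (fun s => (r^T *m X s) i k) (fun=> 0).
    by apply: (primitive_extr H) => s _ //; rewrite !mulmxA rG !mul0mx mxE.
  have H1 := primitive_ler H0 (primitive_const 0) (lexx 0) t0 (fun _ _ _ => lexx _).
  have H2 := primitive_ler (primitive_const 0) H0 (lexx 0) t0 (fun _ _ _ => lexx _).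
  by apply: le_anti; apply/andP; move: H1 H2; rewrite !subr0 subr_le0 subr_ge0 => -> ->.
(* The factor from [bform_sum_le] for a sum of differences weighted by [r]. *)
pose Cr := p%:R * \sum_j r j 0 ^+ 2.
have Cr0 : 0 <= Cr by rewrite mulr_ge0 ?ler0n // sumr_ge0 // => j _; apply: sqr_ge0.
(* The disagreement is quadratic in the distance, hence the square roots and the halved rate;
   [Cr + 1] ensures positivity. *)
exists (Num.sqrt (Cr + 1) * Num.sqrt c), (al / 2).
have Cr1 : 0 < Cr + 1 by rewrite ltr_wpDl.
split; first by rewrite mulr_gt0 ?sqrtr_gt0.
split; first by rewrite divr_gt0.
move=> t t0.
have exp0 s : 0 <= exp s by apply/RleP; apply: Rlt_le; apply: exp_pos.
have rhs0 : 0 <= Num.sqrt (Cr + 1) * Num.sqrt c * exp (- (al / 2) * t).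
  by rewrite !mulr_ge0 ?sqrtr_ge0.
apply: bigmax_le => // i _.
rewrite -(ler_pXn2r (n := 2)) ?nnegrE ?vnorm2_ge0 // vnorm2_sqr.
(* As the weights sum to 1 and [r^T *m X] is conserved, the error is a weighted sum of current
   differences. *)
have -> : (x i t - \sum_j r j 0 *: x j 0)^T = \sum_j r j 0 *: (row i (X t) - row j (X t)).
  under [RHS]eq_bigr do rewrite scalerBr.
  rewrite sumrB -scaler_suml r1 scale1r.
  have -> : \sum_j r j 0 *: row j (X t) = r^T *m X t.
    by rewrite mulmx_sum_row; apply: eq_bigr => j _; rewrite mxE.
  rewrite X_mean //; apply/rowP => k; rewrite !mxE summxE; congr (_ - _).
  by apply: eq_bigr => j _; rewrite !mxE.
have Dc := Hc t t0.
apply: (@le_trans _ _ (Cr * disagreement 1%:M (X t) (X t))).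
  apply: le_trans (bform_sum_le _ (psd1 _ _)) _.
  rewrite -mulrA ler_wpM2l ?ler0n // mulr_suml; apply: ler_sum => j _.
  rewrite bformZl bformZr mulrA -expr2 ler_wpM2l ?sqr_ge0 //.
  exact: disagreement_ge (psd1 _ _).
have -> : (Num.sqrt (Cr + 1) * Num.sqrt c * exp (- (al / 2) * t)) ^+ 2 =
    (Cr + 1) * (c * exp (- al * t)).
  rewrite !exprMn !sqr_sqrtr ?(ltW c0) ?(ltW Cr1) // -mulrA expr2.
  have -> a b : exp a * exp b = exp (a + b) by symmetry; exact: exp_plus.
  congr (_ * (_ * exp _)).
  by change (- (al / 2) * t + - (al / 2) * t = - al * t); field.
apply: le_trans (ler_wpM2l Cr0 Dc) _.
have := mulr_ge0 (ltW c0) (exp0 (- al * t)); lra.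
Qed.
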